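(* Let $d=k=1$ and $M>0$. Let $\psi:\mathbb{R}\to\mathbb{R}$ be continuously differentiable with $\psi'(x)^2\le\frac1{M^2}\psi(x)$ and $\psi(x)\ge1$ for all $x\in\mathbb{R}$. Let $g(x,\sigma)=\frac12x^2\sigma$, $\sigma_T(m)=\int_{\mathbb{R}}\psi\,dm$ for $m\in\mathscr{P}_2(\mathbb{R})$, and $G(x,m)=g(x,\sigma_T(m))$. Then, when restricted to initial random variables $X_0\in\mathbb{H}$ with $\mathbb{E}[|X_0|^2]\le M^2$, $\tilde E_T$ satisfies $(\mathrm{L}^2)$ strictly. However, in general neither $(\sigma)$ nor $-(\sigma)$ holds when restricted to initial measures $m_0\in\mathscr{P}_2(\mathbb{R})$ with $\int_{\mathbb{R}}|x|^2\,dm_0(x)\le M^2$: there exists such a $\psi$ for which both $(\sigma)$ and $-(\sigma)$ fail under this restriction.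
   Context: $\mathscr{P}_2(\mathbb{R})$: Borel probability measures on $\mathbb{R}$ with finite second moment. $(\Omega,\mathcal{A},\mathbb{P})$ is an atomless probability space, $\mathbb{H}=L^2(\Omega;\mathbb{R})$, $\mathcal{L}_X$ the law of $X\in\mathbb{H}$. The Lagrangian is $L(x,v)=\frac12|v|^2$. For an initial random variable $X_0\in\mathbb{H}$ of law $m_0$ and a horizon $T>0$ put $$\tilde E_T(X)=(I+T\,D_xG(\cdot,\mathcal{L}_X))^{-1}(X_0)=\frac{X_0}{1+T\,\mathbb{E}[\psi(X)]},\qquad \Omega(\sigma)=\sigma_T\big((I+T\,D_xg(\cdot,\sigma))^{-1}_\sharp m_0\big)=\int_{\mathbb{R}}\psi\Big(\frac{x}{1+T\sigma}\Big)dm_0(x).$$ $(\mathrm{L}^2)$ strictly, under the restriction: for all $X_0\in\mathbb{H}$ with $\mathbb{E}[|X_0|^2]\le M^2$, all $T>0$ and all $X_1\ne X_2$ in $\mathbb{H}$, $\mathbb{E}[(\tilde E_T(X_1)-\tilde E_T(X_2))(X_1-X_2)]<\mathbb{E}|X_1-X_2|^2$. $(\sigma)$ under the restriction: for all $m_0\in\mathscr{P}_2(\mathbb{R})$ with $\int|x|^2dm_0\le M^2$, all $T>0$ and all $\sigma_1,\sigma_2\in\mathrm{range}\,\sigma_T=\{\int\psi\,dm:m\in\mathscr{P}_2(\mathbb{R})\}$, $(\Omega(\sigma_1)-\Omega(\sigma_2))(\sigma_1-\sigma_2)\le|\sigma_1-\sigma_2|^2$. Condition $-(\sigma)$ is the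 same with $\ge$ in place of $\le$. *)

(* Defs.v *)
From HB Require Import structures.
From mathcomp Require Import all_boot all_order all_algebra.
From mathcomp Require Import all_classical all_reals all_analysis.
Set Implicit Arguments.
Unset Strict Implicit.
Unset Printing Implicit Defensive.
Import Order.TTheory GRing.Theory Num.Theory.
Import numFieldNormedType.Exports.
Local Open Scope classical_set_scope.
Local Open Scope ring_scope.

Definition atomless d (Omega : measurableType d) (R : realType)
    (P : probability Omega R) : Prop :=
  forall A, measurable A -> (0 < P A)%E ->
    exists B, [/\ measurable B, B `<=` A & (0 < P B < P A)%E].

Section Costs.
Context (R : realType).
Implicit Types (psi : R -> R) (M T sigma : R).

Definition admissible M psi : Prop :=
  [/\ forall x, derivable psi x 1,
      continuous (derive1 psi),
      forall x, (derive1 psi x) ^+ 2 <= (M ^+ 2)^-1 * psi x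
    & forall x, 1 <= psi x].

Definition P2 : set (probability (measurableTypeR R) R) :=
  [set m : probability (measurableTypeR R) R |
    (\int[m]_x ((`|(x : R)| ^+ 2)%:E) < +oo)%E].

(* Defined on set functions, so that it applies to pushforwards directly.
   For m in P2 and psi admissible the integral is finite, since psi then has at
   most quadratic growth. *)
Definition sigma_T psi (m : set (measurableTypeR R) -> \bar R) : R :=
  fine (\int[m]_x (psi x)%:E)%E.

Definition g (x sigma : R) : R := 2^-1 * x ^+ 2 * sigma.

Definition G psi (x : R) (m : set (measurableTypeR R) -> \bar R) : R :=
  g x (sigma_T psi m).

(* (I + T F)^-1. It is the two-sided inverse function when x |-> x + T * F x is
   bijective, as for F x = x * sigma with T, sigma > 0. *)
Definition resolvent T (F : R -> R) : R -> R :=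
  'pinv_(fun=> 0) setT (fun x => x + T * F x).

Definition Omega_map psi T (m0 : set (measurableTypeR R) -> \bar R) sigma : R :=
  sigma_T psi
    (pushforward m0
       (resolvent T (derive1 (g ^~ sigma)) : measurableTypeR R -> measurableTypeR R)).

Definition cond_sigma psi M : Prop :=
  forall m0, P2 m0 -> (\int[m0]_x ((`|(x : R)| ^+ 2)%:E) <= (M ^+ 2)%:E)%E ->
  forall T, 0 < T ->
  forall sigma1 sigma2,
    [set sigma_T psi m | m in P2] sigma1 ->
    [set sigma_T psi m | m in P2] sigma2 ->
    (Omega_map psi T m0 sigma1 - Omega_map psi T m0 sigma2)
      * (sigma1 - sigma2) <= `|sigma1 - sigma2| ^+ 2.

Definition cond_minus_sigma psi M : Prop :=
  forall m0, P2 m0 -> (\int[m0]_x ((`|(x : R)| ^+ 2)%:E) <= (M ^+ 2)%:E)%E ->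
  forall T, 0 < T ->
  forall sigma1 sigma2,
    [set sigma_T psi m | m in P2] sigma1 ->
    [set sigma_T psi m | m in P2] sigma2 ->
    (Omega_map psi T m0 sigma1 - Omega_map psi T m0 sigma2)
      * (sigma1 - sigma2) >= `|sigma1 - sigma2| ^+ 2.

End Costs.

(* LspaceType2 P is the quotient by almost sure equality, so X1 <> X2 in it means
   that X1 and X2 are not almost surely equal; its elements coerce to functions
   through a chosen representative. *)
Section Hilbert.
Context d (Omega : measurableType d) (R : realType) (P : probability Omega R).
Implicit Types (psi : R -> R) (M T : R) (X : LspaceType2 P).

Definition law X : probability (measurableTypeR R) R :=
  distribution P (repr (X : {mfun_ P, Omega >-> measurableTypeR R})).

Definition Etilde psi T X0 X : Omega -> R :=
  fun w => resolvent T (derive1 (G psi ^~ (law X))) (X0 w).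

Definition strict_L2 psi M : Prop :=
  forall X0, ('E_P[fun w => (`|X0 w : R| ^+ 2)%R] <= (M ^+ 2)%:E)%E ->
  forall T, 0 < T ->
  forall X1 X2, X1 <> X2 ->
    ('E_P[fun w => ((Etilde psi T X0 X1 w - Etilde psi T X0 X2 w)
                     * ((X1 w : R) - X2 w))%R]
       < 'E_P[fun w => (`|(X1 w : R) - X2 w| ^+ 2)%R])%E.

End Hilbert.

(* Main.v *)
Require Import Defs.
From HB Require Import structures.
From mathcomp Require Import all_boot all_order all_algebra.
From mathcomp Require Import all_classical all_reals all_analysis.
From mathcomp Require Import measurable_realfun ring lra.

(** Write [s_i = E[psi (X_i)]] and [D = X_1 - X_2]. Since [g] is quadratic in [x],
the resolvent is the division by [1 + T * s_i], and the left-hand side of the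
monotonicity condition is [rho * E[X_0 * D]] with
[rho = 1 / (1 + T * s_1) - 1 / (1 + T * s_2)].

The hypothesis [psi'^2 <= psi / M^2] means that [sqrt psi] is Lipschitz with
constant [1 / (2 * M)] ([sqrt_admissible_lipschitz]). Consequently [psi] has
quadratic growth, all integrals are finite, and by the Cauchy-Schwarz inequality
[(s_1 - s_2)^2 <= E[D^2] * (s_1 + s_2) / (2 * M^2)] ([sigma_T_law_dist]). A second
use of Cauchy-Schwarz gives [E[X_0 * D]^2 <= M^2 * E[D^2]], so the square of the
left-hand side is at most [E[D^2]^2] times
[T^2 * (s_1 + s_2) / (2 * (1 + T * s_1)^2 * (1 + T * s_2)^2)]. This factor is
smaller than 1 because [s_i >= 1] ([resolvent_slope_bound]), and [E[D^2] > 0]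
because [X_1] and [X_2] are different classes.

For the negative part, Dirac masses suffice as initial measures. For [m_0] the Dirac
mass at [a], [Omega s = psi (a / (1 + T * s))]. At [a = 0] it is constant, so
the condition [-(sigma)] fails for every nonconstant [psi]. At [a = M] the slope of
[Omega] is [- psi' (M / (1 + T * s)) * M * T / (1 + T * s)^2], which is larger than 1
as soon as [psi] decreases steeply enough on [[0, M]] while [s] remains bounded; this
is compatible with the hypotheses because the admissible slope grows with
[sqrt psi], whereas the range of [psi] may come close to 1 far away from [[0, M]].
A tall Lorentzian bump centred far to the left of 0 has these properties. *)

Set Implicit Arguments.
Unset Strict Implicit.
Unset Printing Implicit Defensive.
Import Order.TTheory GRing.Theory Num.Theory.
Import numFieldNormedType.Exports.
Local Open Scope classical_set_scope.
Local Open Scope ring_scope.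

(** * Square-integrable functions *)

Section SquareIntegrable.
Context d (T : measurableType d) (R : realType).
Context (mu : {measure set T -> \bar R}).
Implicit Types f g : T -> R.

Lemma integrable_sqr_Lfun2 f : measurable_fun setT f ->
  mu.-integrable setT (EFin \o (fun x => f x ^+ 2)) -> f \in Lfun mu 2%:E.
Proof.
move=> mf /integrableP[_ fi].
rewrite inE; apply/andP; split; rewrite inE//=.
rewrite /finite_norm unlock poweR_lty//.
apply: le_lt_trans fi; apply: ge0_le_integral => //.
- by move=> x _; exact: poweR_ge0.
- apply: (measurableT_comp (measurable_poweR _)) => //.
  by apply: measurableT_comp => //; exact/measurable_EFinP.
- by apply: measurableT_comp => //; apply/measurable_EFinP/measurable_funX.
- by move=> x _ /=; rewrite lee_fin normrX powR_mulrn.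
Qed.

Lemma Lfun2_integrable_mul f g : f \in Lfun mu 2%:E -> g \in Lfun mu 2%:E ->
  mu.-integrable setT (EFin \o (f \* g)).
Proof. by move=> f2 g2; apply/Lfun1_integrable/Lfun2_mul_Lfun1. Qed.

(** The quadratic polynomial [t |-> \int (f - t g)^2] is nonnegative, hence its
discriminant is nonpositive. *)
Lemma CauchySchwarz_Rintegral f g :
    f \in Lfun mu 2%:E -> g \in Lfun mu 2%:E ->
  (\int[mu]_x (f x * g x)) ^+ 2
    <= (\int[mu]_x (f x ^+ 2)) * (\int[mu]_x (g x ^+ 2)).
Proof.
move=> f2 g2.
have iff := Lfun2_integrable_sqr f2.
have igg := Lfun2_integrable_sqr g2.
have ifg := Lfun2_integrable_mul f2 g2.
set A := \int[mu]_x (f x ^+ 2); set C := \int[mu]_x (g x ^+ 2).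
set B := \int[mu]_x (f x * g x).
have A0 : 0 <= A by apply: Rintegral_ge0 => x _; exact: sqr_ge0.
have C0 : 0 <= C by apply: Rintegral_ge0 => x _; exact: sqr_ge0.
have key t : 0 <= A - 2 * t * B + t ^+ 2 * C.
  have itg : mu.-integrable setT (EFin \o (fun x => (2 * t) * (f x * g x))).
    exact: integrableZl ifg.
  have itgg : mu.-integrable setT (EFin \o (fun x => t ^+ 2 * (g x ^+ 2))).
    exact: integrableZl igg.
  rewrite -RintegralZl// -RintegralZl// -RintegralB// -RintegralD//; last first.
    by have := integrableB measurableT iff itg.
  apply: Rintegral_ge0 => x _.
  by rewrite (_ : _ + _ = (f x - t * g x) ^+ 2) ?sqr_ge0//; ring.
have [C_eq0|C_neq0] := eqVneq C 0.
  have [->|B_neq0] := eqVneq B 0; first by rewrite expr0n mulr_ge0.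
  (* the polynomial is affine in t, and takes the value -1 at this t *)
  have := key ((A + 1) / (2 * B)).
  rewrite C_eq0 mulr0 addr0 (_ : 2 * _ * B = A + 1); last by field.
  by lra.
(* the minimum of the polynomial is attained at t = B / C *)
have := key (B / C).
have Cp : 0 < C by rewrite lt0r C_neq0.
rewrite (_ : _ + _ = (A * C - B ^+ 2) / C); last by field.
by rewrite pmulr_lge0 ?invr_gt0// subr_ge0.
Qed.

End SquareIntegrable.

Section L2Space.
Context d (Omega : measurableType d) (R : realType) (P : probability Omega R).
Implicit Types X Y : LspaceType2 P.

Lemma LspaceType2_Lfun X : (X : Omega -> R) \in Lfun P 2%:E.
Proof.
rewrite inE; apply/andP; split; rewrite inE/=.
  exact: (@measurable_funPT _ _ _ _
    (repr (X : {mfun_ P, Omega >-> measurableTypeR R}))).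
exact: (@Lebesgue_finite _ _ _ _ _ _ X).
Qed.

Lemma LspaceType2_LfunB X Y : (fun w => X w - Y w) \in Lfun P 2%:E.
Proof.
have X2 := LspaceType2_Lfun X; have Y2 := LspaceType2_Lfun Y.
have [_ addr] := Lfun_addr_closed P (lee1n 2).
exact: (addr _ _ X2 (Lfun_oppr_closed Y2)).
Qed.

Lemma LspaceType2_dist_gt0 X Y : X <> Y ->
  0 < \int[P]_w (X w - Y w) ^+ 2.
Proof.
move=> XY; rewrite lt_neqAle Rintegral_ge0 ?andbT; last first.
  by move=> w _; exact: sqr_ge0.
apply/eqP => D0; apply: XY.
have XY2 := LspaceType2_LfunB X Y.
have mD : measurable_fun setT ((X : Omega -> R) \- Y).
  by case/andP: XY2; rewrite inE.
have /ae_eq_integral_abs :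
    (\int[P]_w `|(((X : Omega -> R) \- Y) w ^+ 2)%:E| = 0)%E.
  under eq_integral do rewrite gee0_abs ?lee_fin ?sqr_ge0//.
  rewrite -[LHS](fineK (integrable_fin_num measurableT
    (Lfun2_integrable_sqr XY2))).
  by congr EFin; exact: esym.
have mD2 : measurable_fun setT (fun w => ((X w - Y w) ^+ 2)%:E).
  by apply/measurable_EFinP; exact: measurable_funX.
move=> /(_ measurableT mD2) D_ae0.
have N : (X : Omega -> R) = (Y : Omega -> R) %[ae P].
  apply: filterS D_ae0 => w /(_ I) [] /eqP.
  by rewrite sqrf_eq0 subr_eq0 => /eqP.
(* equality in the space of classes is almost sure equality of representatives *)
case: X Y N {XY2 mD mD2 D0 D_ae0} => [X [[fX]]] [Y [[fY]]] /= N.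
have XY : X = Y.
  by rewrite -[X]reprK -[Y]reprK; apply/eqmodP/asboolP.
by subst Y; rewrite (Prop_irrelevance fX fY).
Qed.

End L2Space.

(** * The resolvent of the linear map [x |-> x * s] *)

Section Resolvent.
Context (R : realType).
Implicit Types T s x : R.

Lemma derive1_g s : derive1 (@g R ^~ s) = fun x => x * s.
Proof.
apply/funext => x; rewrite derive1E.
have h : is_derive x 1 (@g R ^~ s) (x * s).
  rewrite /g; apply: is_derive_eq.
  by rewrite /GRing.scale/=; field.
by case: h.
Qed.

Lemma resolvent_g T s : 0 < 1 + T * s ->
  resolvent T (derive1 (@g R ^~ s)) = fun x => x / (1 + T * s).
Proof.
move=> h; have h0 : 1 + T * s != 0 by rewrite gt_eqF.
rewrite /resolvent derive1_g; apply/funext => y.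
have surj : set_surj [set: R] [set: R] (fun x => x + T * (x * s)).
  by move=> z _; exists (z / (1 + T * s)) => //; field.
have := surjpK (fun=> 0) surj (in_setT y).
set z := 'pinv_ _ _ _ _ => {1}<-; by field.
Qed.

End Resolvent.
(** * Regularity of admissible costs *)

Section Admissible.
Context (R : realType) (M : R) (psi : R -> R).
Context (M0 : 0 < M) (hpsi : admissible M psi).

Let psi_gt0 x : 0 < psi x.
Proof. by have [_ _ _ p1] := hpsi; exact: lt_le_trans (p1 x). Qed.

Lemma admissible_continuous : continuous psi.
Proof.
have [dpsi _ _ _] := hpsi => x.
exact/differentiable_continuous/derivable1_diffP.
Qed.

Lemma measurable_admissible : measurable_fun setT psi.
Proof. exact: continuous_measurable_fun admissible_continuous. Qed.

(** The differential inequality says exactly that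
[(sqrt psi)' = psi' / (2 * sqrt psi)] is at most [1 / (2 * M)] in absolute
value. *)
Lemma sqrt_admissible_lipschitz x y :
  `|Num.sqrt (psi x) - Num.sqrt (psi y)| <= (2 * M)^-1 * `|x - y|.
Proof.
have [dpsi _ gpsi _] := hpsi.
wlog yx : x y / y <= x.
  move=> H; have [/H //|/ltW /H] := leP y x.
  by rewrite distrC (distrC y).
pose f : R -> R := fun z => Num.sqrt (psi z).
pose df : R -> R := fun z => (2 * Num.sqrt (psi z))^-1 * derive1 psi z.
have fE (z : R) : is_derive z 1 f (df z).
  have h1 : is_derive z 1 psi (derive1 psi z).
    by rewrite derive1E; exact: derivableP.
  have h2 := is_derive1_sqrt (psi_gt0 z).
  by have := is_derive1_comp h2 h1.
have cf : {within `[y, x], continuous f}.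
  apply: continuous_subspaceT => z.
  apply: continuous_comp; first exact: admissible_continuous.
  exact: sqrt_continuous.
have [c _ /= ->] := MVT_segment yx (fun z _ => fE z) cf.
rewrite normrM ler_wpM2r// /df.
have s0 : 0 < Num.sqrt (psi c) by rewrite sqrtr_gt0.
rewrite -ler_sqr ?nnegrE ?invr_ge0 ?mulr_ge0 ?(ltW M0)//.
rewrite real_normK ?num_real// !exprMn !exprVn !exprMn.
rewrite sqr_sqrtr ?(ltW (psi_gt0 c))//.
have := gpsi c; have := psi_gt0 c => p0 H.
apply: le_trans (ler_wpM2l _ H) _; first by rewrite invr_ge0 mulr_ge0 ?ltW.
by rewrite le_eqVlt; apply/orP; left; apply/eqP; field; rewrite !gt_eqF.
Qed.

(** The Lipschitz bound on [sqrt psi], multiplied by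
[sqrt (psi x) + sqrt (psi y)]. *)
Lemma admissible_dist x y : `|psi x - psi y|
  <= `|x - y| * ((Num.sqrt (psi x) + Num.sqrt (psi y)) / (2 * M)).
Proof.
have := sqrt_admissible_lipschitz x y.
rewrite -{2}[psi x]sqr_sqrtr ?(ltW (psi_gt0 _))//.
rewrite -{2}[psi y]sqr_sqrtr ?(ltW (psi_gt0 _))//.
rewrite subr_sqr normrM => H.
rewrite (ger0_norm (addr_ge0 (sqrtr_ge0 _) (sqrtr_ge0 _))) [_ / _]mulrC mulrA.
by rewrite ler_wpM2r ?addr_ge0 ?sqrtr_ge0// [leRHS]mulrC.
Qed.

(** Quadratic growth makes [psi] integrable against every law of finite second
moment. *)
Lemma admissible_growth x : psi x <= 2 * psi 0 + (2 * M ^+ 2)^-1 * x ^+ 2.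
Proof.
have := sqrt_admissible_lipschitz x 0; rewrite subr0 => H.
have H' : Num.sqrt (psi x) <= Num.sqrt (psi 0) + (2 * M)^-1 * `|x|.
  by rewrite -lerBlDl (le_trans (ler_norm _)).
have : Num.sqrt (psi x) ^+ 2 <= (Num.sqrt (psi 0) + (2 * M)^-1 * `|x|) ^+ 2.
  by rewrite ler_sqr ?nnegrE ?addr_ge0 ?sqrtr_ge0 ?mulr_ge0 ?invr_ge0 ?mulr_ge0
    ?(ltW M0).
rewrite sqr_sqrtr ?(ltW (psi_gt0 _))// => /le_trans; apply.
set a := Num.sqrt _; set b := _ * `|x|.
have -> : (2 * M ^+ 2)^-1 * x ^+ 2 = 2 * b ^+ 2.
  rewrite /b exprMn real_normK ?num_real//; field.
  by rewrite gt_eqF.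
rewrite -[psi 0]sqr_sqrtr ?(ltW (psi_gt0 _))// -/a.
by have := sqr_ge0 (a - b); rewrite sqrrB sqrrD; lra.
Qed.

End Admissible.

(** * The map [X |-> E[psi (X)]] on [L^2] *)

Section Law.
Context d (Omega : measurableType d) (R : realType) (P : probability Omega R).
Context (M : R) (psi : R -> R).
Context (M0 : 0 < M) (hpsi : admissible M psi).
Implicit Types X Y : LspaceType2 P.

Lemma admissible_integrable f : f \in Lfun P 2%:E ->
  P.-integrable setT (EFin \o (psi \o f)).
Proof.
move=> f2.
have mf : measurable_fun setT f by case/andP: f2; rewrite inE.
have := integrableD measurableT
  (finite_measure_integrable_cst P (2 * psi 0) measurableT)
  (integrableZl measurableT (2 * M ^+ 2)^-1 (Lfun2_integrable_sqr f2)).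
apply: le_integrable => //.
  apply/measurable_EFinP/measurableT_comp => //; exact: measurable_admissible hpsi.
move=> w _ /=; have [_ _ _ p1] := hpsi.
rewrite lee_fin !ger0_norm.
- exact: admissible_growth.
- apply: le_trans (admissible_growth M0 hpsi (f w)).
  exact: le_trans (p1 _).
- exact: le_trans (p1 _).
Qed.

Lemma sigma_T_law X : sigma_T psi (law X) = \int[P]_w psi (X w).
Proof.
rewrite /sigma_T /law ge0_integral_distribution//.
  apply/measurable_EFinP; exact: measurable_admissible hpsi.
by have [_ _ _ p1] := hpsi => y; rewrite lee_fin (le_trans _ (p1 _)).
Qed.

Lemma sigma_T_law_ge1 X : 1 <= sigma_T psi (law X).
Proof.
have [_ _ _ p1] := hpsi.
rewrite sigma_T_law [leLHS](_ : _ = \int[P]_w (1 : R)); last first.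
  by rewrite Rintegral_cst// [X in fine X](probability_setT P) mul1r.
apply: le_Rintegral => //.
- exact: finite_measure_integrable_cst.
- exact/admissible_integrable/LspaceType2_Lfun.
Qed.

(** Integrating [admissible_dist] and applying Cauchy-Schwarz bounds the squared
difference by [E[(X - Y)^2]] times [E[W^2]], where [W] is the half-sum of
[sqrt (psi X)] and [sqrt (psi Y)] divided by [M]; convexity of the square then
bounds [W^2] by [(psi X + psi Y) / (2 * M^2)]. *)
Lemma sigma_T_law_dist X Y :
  (sigma_T psi (law X) - sigma_T psi (law Y)) ^+ 2
   <= (\int[P]_w (X w - Y w) ^+ 2) *
      ((2 * M ^+ 2)^-1 * (sigma_T psi (law X) + sigma_T psi (law Y))).
Proof.
set D2 := \int[P]_w _; rewrite !sigma_T_law.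
have pX := admissible_integrable (LspaceType2_Lfun X).
have pY := admissible_integrable (LspaceType2_Lfun Y).
have [_ _ _ p1] := hpsi.
have p0 x : 0 <= psi x by exact: le_trans (p1 x).
pose W w := (Num.sqrt (psi (X w)) + Num.sqrt (psi (Y w))) / (2 * M).
have sq f : f \in Lfun P 2%:E ->
    (fun w => Num.sqrt (psi (f w))) \in Lfun P 2%:E.
  move=> f2; have mf : measurable_fun setT f by case/andP: f2; rewrite inE.
  apply: integrable_sqr_Lfun2.
    apply: (measurableT_comp (f := @Num.sqrt R)).
      apply: continuous_measurable_fun; exact: sqrt_continuous.
    exact: measurableT_comp (measurable_admissible hpsi) mf.
  apply: eq_integrable (admissible_integrable f2) => // w _ /=.
  by rewrite sqr_sqrtr.
have W2 : W \in Lfun P 2%:E.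
  have [_ addr] := Lfun_addr_closed P (lee1n 2).
  exact: Lfun_scale (ler1n _ 2)
    (addr _ _ (sq _ (LspaceType2_Lfun X)) (sq _ (LspaceType2_Lfun Y))).
have D2L := LspaceType2_LfunB X Y.
have aD2L : (fun w => `|X w - Y w|) \in Lfun P 2%:E.
  apply: integrable_sqr_Lfun2.
    by apply: measurableT_comp => //; case/andP: D2L; rewrite inE.
  apply: eq_integrable (Lfun2_integrable_sqr D2L) => // w _ /=.
  by rewrite real_normK ?num_real.
have iDW := Lfun2_integrable_mul aD2L W2.
have ipp := integrableB measurableT pX pY.
have ipD : P.-integrable setT (EFin \o (fun w => psi (X w) + psi (Y w))).
  by have := integrableD measurableT pX pY; apply: eq_integrable.
have H1 : `|\int[P]_w psi (X w) - \int[P]_w psi (Y w)|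
    <= \int[P]_w (`|X w - Y w| * W w).
  rewrite -RintegralB//.
  apply: le_trans (le_normr_Rintegral _ _) _ => //.
  apply: le_Rintegral => //.
    exact: integrable_norm.
  by move=> w _; exact: admissible_dist.
have H2 := CauchySchwarz_Rintegral aD2L W2.
have H3 : \int[P]_w (W w ^+ 2)
    <= (2 * M ^+ 2)^-1 * (\int[P]_w psi (X w) + \int[P]_w psi (Y w)).
  rewrite -RintegralD// -RintegralZl//.
  apply: le_Rintegral => //.
  - exact: Lfun2_integrable_sqr.
  - exact: (integrableZl measurableT (2 * M ^+ 2)^-1 ipD).
  - move=> w _; rewrite /W exprMn.
    set a := Num.sqrt _; set b := Num.sqrt _.
    rewrite -[psi (X w)]sqr_sqrtr// -[psi (Y w)]sqr_sqrtr// -/a -/b.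
    have := sqr_ge0 (a - b); rewrite sqrrB sqrrD => ab.
    rewrite [leLHS](_ : _ = (2 * (2 * M ^+ 2))^-1 * (a + b) ^+ 2); last first.
      by field; rewrite gt_eqF.
    rewrite invfM (mulrC 2^-1) -mulrA ler_wpM2l ?invr_ge0 ?mulr_ge0 ?(ltW M0)//.
    by rewrite mulrC ler_pdivrMr// sqrrD; lra.
rewrite -[leLHS]real_normK ?num_real//.
apply: le_trans (_ : (\int[P]_w (`|X w - Y w| * W w)) ^+ 2 <= _).
  by rewrite ler_sqr ?nnegrE ?(le_trans _ H1).
apply: le_trans H2 _.
rewrite /D2; under [X in X * _]eq_Rintegral do rewrite real_normK ?num_real//.
by rewrite ler_wpM2l// Rintegral_ge0// => w _; exact: sqr_ge0.
Qed.

End Law.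

(** * Strict monotonicity in [L^2] *)

(** This is where the lower bound 1 on [psi] enters: for [a, b >= 1] one has
[a + b <= a^2 + b^2], so that [1 + T^2 (a + b)] is at most
[1 + (T a)^2 + (T b)^2], which the square on the right dominates. *)
Lemma resolvent_slope_bound (R : realType) (T a b : R) :
  0 < T -> 1 <= a -> 1 <= b ->
  T ^+ 2 * (a + b) < 2 * ((1 + T * a) * (1 + T * b)) ^+ 2.
Proof.
move=> T0 a1 b1.
have Ta : 0 <= T * a by rewrite mulr_ge0 ?ltW// (lt_le_trans ltr01).
have Tb : 0 <= T * b by rewrite mulr_ge0 ?ltW// (lt_le_trans ltr01).
have T2 : 0 <= T ^+ 2 by exact: sqr_ge0.
have h1 : T ^+ 2 * a <= (T * a) ^+ 2.
  by rewrite exprMn ler_wpM2l// expr2 ler_peMr// (le_trans ler01).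
have h2 : T ^+ 2 * b <= (T * b) ^+ 2.
  by rewrite exprMn ler_wpM2l// expr2 ler_peMr// (le_trans ler01).
have h3 : 1 + T * a + T * b <= (1 + T * a) * (1 + T * b).
  by rewrite mulrDr mulr1 mulrDl mul1r; have := mulr_ge0 Ta Tb; lra.
have h4 : (1 + T * a + T * b) ^+ 2 <= ((1 + T * a) * (1 + T * b)) ^+ 2.
  by rewrite ler_sqr ?nnegrE ?mulr_ge0 ?addr_ge0.
have h5 : 1 + (T * a) ^+ 2 + (T * b) ^+ 2 <= (1 + T * a + T * b) ^+ 2.
  have := mulr_ge0 Ta Tb; nra.
by nra.
Qed.

Section StrictL2.
Context d (Omega : measurableType d) (R : realType) (P : probability Omega R).
Context (M : R) (psi : R -> R).
Context (M0 : 0 < M) (hpsi : admissible M psi).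

Lemma strict_L2_admissible : strict_L2 P psi M.
Proof.
move=> X0 hX0 T T0 X1 X2 X12.
have X0L := LspaceType2_Lfun X0.
have DL := LspaceType2_LfunB X1 X2.
have D0 := LspaceType2_dist_gt0 X12.
have dist := sigma_T_law_dist M0 hpsi X1 X2.
have s11 := sigma_T_law_ge1 M0 hpsi X1.
have s21 := sigma_T_law_ge1 M0 hpsi X2.
pose s1 := sigma_T psi (law X1); pose s2 := sigma_T psi (law X2).
rewrite -/s1 -/s2 in dist s11 s21.
have c1 : 0 < 1 + T * s1.
  by rewrite ltr_pwDl// mulr_ge0 ?(ltW T0)// (le_trans ler01).
have c2 : 0 < 1 + T * s2.
  by rewrite ltr_pwDl// mulr_ge0 ?(ltW T0)// (le_trans ler01).
pose rho := (1 + T * s1)^-1 - (1 + T * s2)^-1.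
have i0D := Lfun2_integrable_mul X0L DL.
have i00 := Lfun2_integrable_sqr X0L.
have iDD := Lfun2_integrable_sqr DL.
have E0 : \int[P]_w (X0 w ^+ 2) <= M ^+ 2.
  rewrite -lee_fin fineK; last exact: integrable_fin_num.
  apply: le_trans hX0; rewrite unlock le_eqVlt; apply/orP; left; apply/eqP.
  by apply: eq_integral => w _; rewrite real_normK ?num_real.
have E1 : ('E_P[fun w => ((Etilde psi T X0 X1 w - Etilde psi T X0 X2 w)
      * ((X1 w : R) - X2 w))%R] = (rho * \int[P]_w (X0 w * (X1 w - X2 w)))%:E)%E.
  rewrite unlock -RintegralZl// fineK; last first.
    by apply: integrable_fin_num => //; exact: (integrableZl measurableT rho i0D).
  apply: eq_integral => w _; congr EFin.
  rewrite /Etilde !resolvent_g// -/s1 -/s2 /rho; ring.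
have E2 : ('E_P[fun w => (`|(X1 w : R) - X2 w| ^+ 2)%R]
    = (\int[P]_w (X1 w - X2 w) ^+ 2)%:E)%E.
  rewrite unlock fineK; last exact: integrable_fin_num.
  by apply: eq_integral => w _; rewrite real_normK ?num_real.
rewrite E1 E2 lte_fin.
have CS := CauchySchwarz_Rintegral X0L DL.
move: E0 CS D0 dist.
set D2 := \int[P]_w (_ - _) ^+ 2; set B := \int[P]_w (X0 w * _).
set A := \int[P]_w X0 w ^+ 2.
move=> E0 CS D0 dist.
rewrite (le_lt_trans (ler_norm _))// -ltr_sqr ?nnegrE ?(ltW D0)//.
rewrite real_normK ?num_real// exprMn.
set q := (1 + T * s1) * (1 + T * s2).
have q0 : 0 < q by rewrite mulr_gt0.
have rhoE : rho ^+ 2 = T ^+ 2 * (s1 - s2) ^+ 2 / q ^+ 2.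
  by rewrite /rho /q; field; rewrite !gt_eqF.
have hB : B ^+ 2 <= M ^+ 2 * D2 by rewrite (le_trans CS)// ler_wpM2r// ltW.
rewrite rhoE mulrAC ltr_pdivrMr ?exprn_gt0//.
apply: (@le_lt_trans _ _
  (T ^+ 2 * (D2 * ((2 * M ^+ 2)^-1 * (s1 + s2))) * (M ^+ 2 * D2))).
  apply: ler_pM => //; [by apply: mulr_ge0; exact: sqr_ge0|exact: sqr_ge0|].
  by rewrite ler_wpM2l ?sqr_ge0.
(* the two factors M^2 cancel: the bound M on X0 offsets the slope of psi *)
rewrite (_ : _ * (M ^+ 2 * D2) = D2 ^+ 2 * (T ^+ 2 * (s1 + s2) / 2)); last first.
  by field; rewrite gt_eqF.
rewrite ltr_pM2l ?exprn_gt0// ltr_pdivrMr// mulrC.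
have := resolvent_slope_bound T0 s11 s21; rewrite -/q; lra.
Qed.

End StrictL2.

(** * Dirac masses *)

Section Dirac.
Context (R : realType).
Implicit Types (psi : R -> R) (T s a : R).

Lemma integral_dirac_EFin psi a : measurable_fun setT psi ->
  (\int[dirac (a : measurableTypeR R)]_x (psi x)%:E = (psi a)%:E)%E.
Proof.
move=> mpsi; rewrite integral_dirac ?diracT ?mul1e//.
exact/measurable_EFinP.
Qed.

Lemma sigma_T_dirac psi a : measurable_fun setT psi ->
  sigma_T psi (dirac (a : measurableTypeR R)) = psi a.
Proof. by move=> mpsi; rewrite /sigma_T integral_dirac_EFin. Qed.

Lemma Omega_map_dirac psi T a s : measurable_fun setT psi ->
  0 < 1 + T * s ->
  Omega_map psi T (dirac (a : measurableTypeR R)) s = psi (a / (1 + T * s)).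
Proof.
move=> mpsi h; rewrite /Omega_map resolvent_g//.
exact: (sigma_T_dirac (a / (1 + T * s)) mpsi).
Qed.

Lemma dirac_second_moment a :
  (\int[dirac (a : measurableTypeR R)]_x ((`|(x : R)| ^+ 2)%:E)
     = (`|a| ^+ 2)%:E)%E.
Proof.
apply: (integral_dirac_EFin (psi := fun x => `|x| ^+ 2)).
by apply: measurable_funX; exact: normr_measurable.
Qed.

Lemma dirac_P2 a : P2 (dirac (a : measurableTypeR R) : probability _ R).
Proof. by rewrite /P2/= [ltLHS]dirac_second_moment ltry. Qed.

End Dirac.

(** * A bump cost violating both conditions on [Omega] *)

Section Bump.
Context (R : realType).
Implicit Types M r s x : R.

(** A Lorentzian bump of height [r^2] centred at [- r * M], so that the points
[M / (1 + T * s)], which lie between [0] and [M], are on its decreasing flank,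
where [M] times its slope is of order [- r / 2] when [r] is large. *)
Definition bump M r x : R := 1 + r ^+ 4 / (r ^+ 2 + (x / M + r) ^+ 2).

Lemma bump_admissible M r : 0 < M -> 0 < r -> admissible M (bump M r).
Proof.
move=> M0 r0; have Mn0 : M != 0 by rewrite gt_eqF.
pose q (x : R) := r ^+ 2 + (x / M + r) ^+ 2.
have q0 x : 0 < q x by rewrite ltr_pwDl ?exprn_gt0// sqr_ge0.
have qn0 x : q x != 0 by rewrite gt_eqF.
pose db (x : R) := - (r ^+ 4 * (2 * (x / M + r)) / (q x ^+ 2 * M)).
have D (x : R) : is_derive x (1 : R) (bump M r) (db x).
  have Dq : is_derive x (1 : R) q (2 * (x / M + r) / M).
    by rewrite /q; apply: is_derive_eq; rewrite /GRing.scale/=; ring.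
  have Dqi := is_deriveV (qn0 x) Dq.
  rewrite /bump; apply: is_derive_eq.
  by rewrite /GRing.scale/= /db; field; rewrite Mn0 qn0.
have dE : derive1 (bump M r) = db.
  by apply/funext => x; rewrite derive1E; case: (D x).
have cv : continuous (fun x : R => x / M + r).
  by move=> x; apply: cvgD; [apply: cvgMl; exact: cvg_id|exact: cvg_cst].
have cq : continuous q.
  by move=> x; apply: cvgD; [exact: cvg_cst|apply: cvgM; exact: cv].
split.
- by move=> x; case: (D x).
- rewrite dE => x; apply: cvgN; apply: cvgM.
    by apply: cvgM; [exact: cvg_cst|apply: cvgM; [exact: cvg_cst|exact: cv]].
  apply: cvgV; first by rewrite mulf_neq0 ?expf_neq0.
  by apply: cvgM; [apply: cvgM; exact: cq|exact: cvg_cst].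
- move=> x; rewrite dE /db /bump -/(q x); set v := x / M + r.
  (* 4 r^2 v^2 <= (r^2 + v^2)^2 and r^2 <= r^2 + v^2 *)
  have amgm : 4 * r ^+ 4 * v ^+ 2 <= q x ^+ 3.
    have h : 4 * r ^+ 2 * v ^+ 2 <= q x ^+ 2.
      rewrite -subr_ge0 (_ : _ - _ = (r ^+ 2 - v ^+ 2) ^+ 2) ?sqr_ge0//.
      by rewrite /q -/v; ring.
    rewrite [leRHS]exprSr.
    rewrite (_ : 4 * _ * _ = 4 * r ^+ 2 * v ^+ 2 * r ^+ 2); last by ring.
    apply: ler_pM => //; rewrite ?sqr_ge0//.
      by apply: mulr_ge0; [apply: mulr_ge0 => //|]; exact: sqr_ge0.
    by rewrite /q lerDl sqr_ge0.
  rewrite [leLHS](_ : _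
      = M ^- 2 * (r ^+ 4 / q x ^+ 4 * (4 * r ^+ 4 * v ^+ 2))); last first.
    by field; rewrite Mn0 qn0.
  rewrite ler_wpM2l ?invr_ge0 ?sqr_ge0//.
  apply: (@le_trans _ _ (r ^+ 4 / q x ^+ 4 * q x ^+ 3)).
    by rewrite ler_wpM2l ?divr_ge0 ?exprn_ge0 ?(ltW (q0 x)) ?(ltW r0).
  by rewrite (_ : _ * _ = r ^+ 4 / q x) ?lerDr//; field.
- by move=> x; rewrite lerDl divr_ge0 ?exprn_ge0 ?(ltW (q0 x)) ?(ltW r0).
Qed.

Lemma bump_scale M r b : 0 < M -> bump M r (M * b)
  = 1 + r ^+ 4 / (r ^+ 2 + (b + r) ^+ 2).
Proof. by move=> M0; rewrite /bump (mulrAC M) divff ?gt_eqF// mul1r. Qed.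

(** Every value in [(1, 1 + r^2]] is taken by the bump itself, hence by a Dirac
mass. *)
Lemma range_bump M r s : 0 < M -> 0 < r -> 1 < s <= 1 + r ^+ 2 ->
  [set sigma_T (bump M r) m | m in @P2 R] s.
Proof.
move=> M0 r0 /andP[s1 sr].
have sm0 : 0 < s - 1 by rewrite subr_gt0.
pose b := Num.sqrt (r ^+ 4 / (s - 1) - r ^+ 2) - r.
have mb : measurable_fun setT (bump M r).
  exact: measurable_admissible (bump_admissible M0 r0).
exists (dirac (M * b : measurableTypeR R)); first exact: dirac_P2.
rewrite [LHS](sigma_T_dirac (M * b) mb) bump_scale// /b subrK sqr_sqrtr.
  by rewrite subrKC; field; rewrite !gt_eqF.
rewrite subr_ge0 ler_pdivlMr// (_ : r ^+ 4 = r ^+ 2 * r ^+ 2); last by ring.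
by rewrite ler_pM2l ?exprn_gt0// lerBlDl.
Qed.

(** The Dirac mass at 0 is fixed by the resolvents, so [Omega] is constant; the
values [s <> t] below are any two points of the range. *)
Lemma bump_not_cond_minus_sigma M r : 0 < M -> 0 < r ->
  ~ cond_minus_sigma (bump M r) M.
Proof.
move=> M0 r0 H.
have mb : measurable_fun setT (bump M r).
  exact: measurable_admissible (bump_admissible M0 r0).
have r20 : 0 < r ^+ 2 by rewrite exprn_gt0.
pose s := 1 + r ^+ 2; pose t := 1 + r ^+ 2 / 2.
have rs : [set sigma_T (bump M r) m | m in @P2 R] s.
  by apply: range_bump => //; rewrite /s ltrDl r20/=.
have rt : [set sigma_T (bump M r) m | m in @P2 R] t.
  by apply: range_bump => //; rewrite /t; apply/andP; split; lra.
have := H _ (dirac_P2 0) _ 1 ltr01 _ _ rs rt.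
rewrite dirac_second_moment normr0 expr0n /= lee_fin => /(_ (sqr_ge0 _)).
rewrite !Omega_map_dirac//; try by rewrite /s /t; lra.
rewrite !mul0r subrr mul0r real_normK ?num_real//.
move=> st_le0; have : (s - t) ^+ 2 == 0 by rewrite eq_le st_le0 sqr_ge0.
by rewrite sqrf_eq0 /s /t => /eqP; lra.
Qed.

(** With [T = 1] and the Dirac mass at [M], [Omega] maps [s] to
[bump M 50 (M / (1 + s))]. Between [s = 2] and [s = 3] the argument moves by
[M / 12] to the left up the flank of slope close to [- 25 / M], so that [Omega]
increases by about [2], twice the increment of [s]. *)
Lemma bump_not_cond_sigma M : 0 < M -> ~ cond_sigma (bump M 50) M.
Proof.
move=> M0 H; have r0 : 0 < 50 :> R by [].
have mb : measurable_fun setT (bump M 50).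
  exact: measurable_admissible (bump_admissible M0 r0).
have r2 : [set sigma_T (bump M 50) m | m in @P2 R] 2.
  by apply: range_bump => //; apply/andP; split; lra.
have r3 : [set sigma_T (bump M 50) m | m in @P2 R] 3.
  by apply: range_bump => //; apply/andP; split; lra.
have := H _ (dirac_P2 M) _ 1 ltr01 _ _ r2 r3.
rewrite dirac_second_moment ger0_norm ?(ltW M0)// => /(_ (lexx _)).
rewrite !Omega_map_dirac//; try by lra.
rewrite !bump_scale// !mul1r real_normK ?num_real//.
rewrite (_ : 1 + 2 = 3 :> R); last by lra.
rewrite (_ : 1 + 3 = 4 :> R); last by lra.
have b2 : 50 ^+ 4 / (50 ^+ 2 + (3^-1 + 50) ^+ 2) <= 1242 :> R.
  by rewrite ler_pdivrMr; lra.
have b3 : 1243 + 2^-1 <= 50 ^+ 4 / (50 ^+ 2 + (4^-1 + 50) ^+ 2) :> R.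
  by rewrite ler_pdivlMr; lra.
move: b2 b3; set x := _ / _; set y := _ / _; lra.
Qed.

End Bump.

Theorem proposition4p7 (R : realType) (d : measure_display)
    (Omega : measurableType d) (P : probability Omega R) (hP : atomless P)
    (M : R) (hM : 0 < M) :
  (forall psi : R -> R, admissible M psi -> strict_L2 P psi M) /\
  (exists psi : R -> R,
     [/\ admissible M psi, ~ cond_sigma psi M & ~ cond_minus_sigma psi M]).
Proof.
split; first by move=> psi; exact: strict_L2_admissible.
exists (bump M 50); split.
- exact: bump_admissible.
- exact: bump_not_cond_sigma.
- exact: bump_not_cond_minus_sigma.
Qed.
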